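(* Let $F$ be a totally imaginary number field and $\mu=(a^\eta,b^\eta)_{\eta:F\to\mathbb{C}}$ a strongly pure weight of $M_\beta\simeq\mathrm{Res}_{F/\mathbb{Q}}GL_2$ with purity weight $\mathbf{w}$. Let $\sigma_f\in\mathrm{Coh}_{!!}(\mathrm{Res}_{F/\mathbb{Q}}GL_2,\mu)$ and let $\sigma=\sigma_f\otimes\sigma_\infty$ be the associated cohomological cuspidal automorphic representation of $GL_2(\mathbb{A}_F)$. Put $$\ell_1(\mu)=\min_{\eta:F\to\mathbb{C}}\{|4b^\eta-2a^\eta-\mathbf{w}-3|,\ |2b^\eta-\mathbf{w}-1|,\ |2a^\eta-\mathbf{w}+1|,\ |4a^\eta-2b^\eta-\mathbf{w}+3|\},$$ $$\ell_2(\mu)=\min_{\eta:F\to\mathbb{C}}\{|a^\eta+b^\eta-\mathbf{w}|\}.$$ The following are equivalent: (1) The point $s=-\frac52$ is a critical point for both $L(s,\mathrm{Ad}^3(\sigma))L(2s,\omega_\sigma)$ and $L(1+s,\mathrm{Ad}^3(\sigma))L(1+2s,\omega_\sigma)$. (2) $-3-\ell_1(\mu)\le\mathbf{w}\le-7+\ell_1(\mu)$, $\;-4-\ell_2(\mu)\le\mathbf{w}\le-6+\ell_2(\mu)$, $\;\ell_1(\mu)\ge2$ and $\ell_2(\mu)\ge1$. (3) There exists a balanced Kostant representative $w=(w^\eta)\in W^{P_\beta}$ such that $w^{-1}\cdot\mu$ is a dominant weight of $G=\mathrm{Res}_{F/\mathbb{Q}}(G_2/F)$.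
   Context: Weights. $\mu=(\mu^\eta)_{\eta:F\to\mathbb{C}}$ with $\mu^\eta=(a^\eta,b^\eta)\in\mathbb{Z}^2$, $a^\eta\ge b^\eta$. It is strongly pure with purity weight $\mathbf{w}\in\mathbb{Z}$ if $a^{\gamma^{-1}\circ\eta}+b^{\gamma^{-1}\circ\bar\eta}=\mathbf{w}$ for all $\eta:F\to\mathbb{C}$ and all $\gamma\in\mathrm{Gal}(\overline{\mathbb{Q}}/\mathbb{Q})$; in particular $(a^{\bar\eta},b^{\bar\eta})=(\mathbf{w}-b^\eta,\mathbf{w}-a^\eta)$. Representation. $\mathrm{Coh}_{!!}(\mathrm{Res}_{F/\mathbb{Q}}GL_2,\mu)$ is the set of finite parts of cuspidal automorphic representations of $GL_2(\mathbb{A}_F)$ contributing to cuspidal cohomology with coefficients in the local system of highest weight $\mu$. The archimedean part is $\sigma_\infty=\otimes_v\mathbb{J}_{\mu_v}$, where for a complex place $v$ with embeddings $\eta,\bar\eta$, $\mathbb{J}_{\mu_v}$ is the normalized parabolically induced representation of $GL_2(\mathbb{C})$ from the Borel character $z^{-b^\eta+1/2}\bar z^{-a^{\bar\eta}-1/2}\otimes z^{-a^\eta-1/2}\bar z^{-b^{\bar\eta}+1/2}$. $\omega_\sigma$ is the central character and $\mathrm{Ad}^3(\sigma)=\mathrm{Sym}^3(\sigma)\otimes\omega_\sigma^{-1}$. Critical points. $s_0\in\frac12+\mathbb{Z}$ is critical for $L(s,\mathrm{Ad}^3(\sigma))$ if the archimedean factors $L_\infty(s,\mathrm{Ad}^3(\sigma))$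 and $L_\infty(1-s,\mathrm{Ad}^3(\sigma)^\vee)$ are both finite at $s_0$; an integer $n$ is critical for $L(s,\omega_\sigma)$ if $L_\infty(s,\omega_\sigma)$ and $L_\infty(1-s,\omega_\sigma^{-1})$ are both finite at $n$. Condition (1) means that $-\frac52$ and $-\frac32$ are critical for $L(s,\mathrm{Ad}^3(\sigma))$ and $-5$ and $-4$ are critical for $L(s,\omega_\sigma)$. Root data. $G_2$ has simple roots $\alpha$ (short), $\beta$ (long), positive roots $\alpha,\beta,\alpha+\beta,2\alpha+\beta,3\alpha+\beta,3\alpha+2\beta$, $\rho=5\alpha+3\beta$. $P_\beta=M_\beta U_\beta$ is the standard maximal parabolic of $G$ whose Levi contains $\beta$; the weight $(a,b)$ of $M_{0,\beta}\simeq GL_2$ is the weight $a(\alpha+\beta)+b\alpha$ of $G_2$, so it is dominant for $G_2$ iff $b\le a\le2b$. The Weyl group is $W=\prod_{\eta:F\to\mathbb{C}}W_0$ with $W_0$ the Weyl group of $G_2$; $W^{P_\beta}=\{w=(w^\eta):(w^\eta)^{-1}\beta>0\ \forall\eta\}$; the twisted action is $w\cdot\lambda=(w^\eta(\lambda^\eta+\rho)-\rho)_\eta$, with dominance required at every $\eta$. An element $w\in W^{P_\beta}$ is balanced if $l(w^\eta)+l(w^{\bar\eta})=\dim(U_{P_{0,\beta}})=5$ for every $\eta$. *)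

(* Defs.v *)
From HB Require Import structures.
From mathcomp Require Import all_boot all_order all_algebra all_field.
From mathcomp Require Import complex.
From mathcomp Require Import all_classical all_reals all_analysis.

Set Implicit Arguments.
Unset Strict Implicit.
Unset Printing Implicit Defensive.

Import Order.TTheory GRing.Theory Num.Theory.
Import numFieldNormedType.Exports.

Local Open Scope ring_scope.
Local Open Scope complex_scope.

Definition emb (R : realType) (F : fieldExtType rat) := {rmorphism F -> R[i]}.

Section Embeddings.
Variables (R : realType) (F : fieldExtType rat).
Implicit Types eta : emb R F.

Lemma embP eta eta' : (forall x, eta x = eta' x) -> eta = eta'.
Proof.
case: eta => f cf; case: eta' => g cg /= efg.
have efg' : f = g by apply/funext.
move: cf cg efg; rewrite efg' => cf cg _; congr GRing.RMorphism.Pack.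
case: cf cg => [a1 a2] [b1 b2].
congr GRing.RMorphism.Class.
  case: a1 b1 => [p] [q]; congr GRing.isNmodMorphism.Axioms_.
  exact: Prop_irrelevance.
case: a2 b2 => [p] [q]; congr GRing.isMonoidMorphism.Axioms_.
exact: Prop_irrelevance.
Qed.

Lemma emb_minpoly (x : F) : {q : {poly rat} | q != 0 &
  forall eta, root (map_poly ratr q) (eta x)}.
Proof.
have /polyOver1P/cid[q qE] := minPolyOver 1%AS x.
exists q.
  apply/eqP => q0; have := monic_minPoly 1%AS x.
  by rewrite qE q0 map_poly0 monicE lead_coef0 eq_sym oner_eq0.
move=> eta; have := root_minPoly 1%AS x; rewrite qE => rq.
have -> : map_poly ratr q = map_poly eta (map_poly (in_alg F) q).
  rewrite -map_poly_comp; apply: eq_map_poly => a /=.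
  by rewrite alg_num_field fmorph_rat.
exact: rmorph_root.
Qed.

Lemma emb_fin_inj :
  exists (T : finType) (f : emb R F -> T), injective f.
Proof.
have roots (x : F) : {rs : seq R[i] | forall eta, eta x \in rs}.
  have [q q0 rq] := emb_minpoly x.
  have [rs rsE] := closed_field_poly_normal (map_poly ratr q : {poly R[i]}).
  exists rs => eta; have := rq eta.
  by rewrite {1}rsE rootZ ?lead_coef_eq0 ?map_poly_eq0 // root_prod_XsubC.
pose b := vbasis (@fullv _ F).
pose n := \dim (@fullv _ F).
pose rs := flatten [seq sval (roots b`_i) | i <- iota 0 n].
have rsP eta (i : 'I_n) : eta b`_i \in rs.
  apply/flattenP; exists (sval (roots b`_i)); last exact: (svalP (roots b`_i)).
  by apply/mapP; exists (i : nat); rewrite ?mem_iota ?add0n ?ltn_ord.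
exists {ffun 'I_n -> seq_sub rs}.
exists (fun eta => [ffun i => SeqSub (rsP eta i)]).
move=> eta eta' /ffunP e; apply: embP => x.
rewrite (coord_vbasis (memvf x)) !rmorph_sum /=; apply: eq_bigr => i _.
have lin (e0 : emb R F) c y : e0 (c *: y) = ratr c * e0 y.
  by rewrite -mulr_algl rmorphM alg_num_field fmorph_rat.
by rewrite !lin; have := congr1 val (e i); rewrite !ffunE /= => ->.
Qed.
End Embeddings.

HB.instance Definition _ (R : realType) (F : fieldExtType rat) :=
  gen_eqMixin (emb R F).
HB.instance Definition _ (R : realType) (F : fieldExtType rat) :=
  gen_choiceMixin (emb R F).


Lemma emb_finite (R : realType) (F : fieldExtType rat) :
  exists s : seq (emb R F), forall eta, eta \in s.
Proof.
have [T [f f_inj]] := emb_fin_inj R F.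
pose g t := if pselect (exists eta, f eta = t) is left h then Some (sval (cid h))
            else None.
exists (pmap g (enum T)) => eta; rewrite mem_pmap; apply/mapP.
exists (f eta); rewrite ?mem_enum // /g.
case: pselect => [h|[]]; last by exists eta.
by congr Some; apply: f_inj; case: cid.
Qed.


Fact emb_pickleK (R : realType) (F : fieldExtType rat) :
  let s := sval (cid (emb_finite R F)) in
  pcancel (fun eta : emb R F => index eta s) (onth s).
Proof.
move=> s eta; have es : eta \in s by rewrite /s; case: cid.
by rewrite onthE (nth_map eta) ?index_mem // nth_index.
Qed.

HB.instance Definition _ (R : realType) (F : fieldExtType rat) :=
  isCountable.Build (emb R F) (@emb_pickleK R F).

Fact emb_enumP (R : realType) (F : fieldExtType rat) :
  Finite.axiom (undup (sval (cid (emb_finite R F)))).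
Proof.
by move=> eta; rewrite count_uniq_mem ?undup_uniq // mem_undup; case: cid => s ->.
Qed.

HB.instance Definition _ (R : realType) (F : fieldExtType rat) :=
  fintype.isFinite.Build (emb R F) (@emb_enumP R F).

Section Galois.
Variables (R : realType) (F : fieldExtType rat).

Definition algebraic_number : {pred R[i]} :=
  fun z => `[< algebraicOver (ratr : rat -> R[i]) z >].

Fact algebraic_number_divring : divring_closed algebraic_number.
Proof.
split; first by apply/asboolP; exact: algebraic1.
  by move=> x y /asboolP ax /asboolP ay; apply/asboolP/algebraic_sub.
by move=> x y /asboolP ax /asboolP ay; apply/asboolP/algebraic_div.
Qed.
HB.instance Definition _ :=
  GRing.isDivringClosed.Build R[i] algebraic_number algebraic_number_divring.

Record Qbar := AlgNumber { Qbar_val : R[i]; _ : Qbar_val \in algebraic_number }.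
HB.instance Definition _ := [isSub for Qbar_val].
HB.instance Definition _ := [Choice of Qbar by <:].
HB.instance Definition _ := [SubChoice_isSubIntegralDomain of Qbar by <:].
HB.instance Definition _ := [SubIntegralDomain_isSubField of Qbar by <:].

Definition conj_emb (eta : emb R F) : emb R F := conjc \o eta.

Fact emb_algebraic (eta : emb R F) x : eta x \in algebraic_number.
Proof.
have [q q0 rq] := @emb_minpoly R F x.
by apply/asboolP; exists q; rewrite ?rq.
Qed.

Definition emb_Qbar (eta : emb R F) (x : F) : Qbar :=
  AlgNumber (emb_algebraic eta x).

Fact emb_Qbar_zmod eta : zmod_morphism (emb_Qbar eta).
Proof. by move=> x y; apply: val_inj; rewrite /= rmorphB. Qed.
HB.instance Definition _ eta :=
  GRing.isZmodMorphism.Build F Qbar (emb_Qbar eta) (emb_Qbar_zmod eta).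
Fact emb_Qbar_monoid eta : monoid_morphism (emb_Qbar eta).
Proof.
by split=> [|x y]; apply: val_inj; rewrite /= ?rmorph1 ?rmorphM.
Qed.
HB.instance Definition _ eta :=
  GRing.isMonoidMorphism.Build F Qbar (emb_Qbar eta) (emb_Qbar_monoid eta).

Definition gal_emb (gamma : {rmorphism Qbar -> Qbar}) (eta : emb R F) : emb R F :=
  (\val : Qbar -> R[i]) \o gamma \o emb_Qbar eta.

End Galois.

Section Weights.
Variables (R : realType) (F : fieldExtType rat).

Definition totally_imaginary := forall eta : emb R F, conj_emb eta <> eta.

Definition is_weight (mu : emb R F -> int * int) :=
  forall eta, (mu eta).2 <= (mu eta).1.

Definition strongly_pure (mu : emb R F -> int * int) (w : int) :=
  forall gamma gammaV : {rmorphism Qbar R -> Qbar R},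
    cancel gamma gammaV -> cancel gammaV gamma ->
  forall eta, (mu (gal_emb gammaV eta)).1
              + (mu (gal_emb gammaV (conj_emb eta))).2 = w.

(* The least element of a nonempty set of natural numbers. *)
Definition nat_min (A : set nat) : nat :=
  xget 0%N [set n | A n /\ forall m, A m -> (n <= m)%N]%classic.

Definition ell1 (mu : emb R F -> int * int) (w : int) : nat :=
  nat_min [set n | exists eta, let: (a, b) := mu eta in
    n \in map absz [:: 4 * b - 2 * a - w - 3; 2 * b - w - 1;
                       2 * a - w + 1; 4 * a - 2 * b - w + 3]%R]%classic.

Definition ell2 (mu : emb R F -> int * int) (w : int) : nat :=
  nat_min [set n | exists eta, let: (a, b) := mu eta in
    n = absz (a + b - w)%R]%classic.

End Weights.

(* The weight x alpha + y beta of G2 is the column vector (x, y); the root and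
   weight lattices of G2 coincide. *)
Section G2.

Definition wt (x y : int) : 'cV[int]_2 := \col_(i < 2) (if i == 0 then x else y).

Definition sroot_alpha := wt 1 0.
Definition sroot_beta := wt 0 1.
Definition rho := wt 5 3.

Definition pos_roots : seq 'cV[int]_2 :=
  [:: wt 1 0; wt 0 1; wt 1 1; wt 2 1; wt 3 1; wt 3 2].

(* Rows of the Cartan matrix: < alpha, beta^v > = -1, < beta, alpha^v > = -3. *)
Definition coroot_alpha : 'rV[int]_2 := \row_(j < 2) (if j == 0 then 2 else -3).
Definition coroot_beta : 'rV[int]_2 := \row_(j < 2) (if j == 0 then -1 else 2).

Definition dominant (l : 'cV[int]_2) :=
  0 <= (coroot_alpha *m l) 0 0 /\ 0 <= (coroot_beta *m l) 0 0.

Definition simple_refl (b : bool) : 'M[int]_2 :=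
  if b then 1%:M - sroot_beta *m coroot_beta
  else 1%:M - sroot_alpha *m coroot_alpha.

Definition weyl_word (s : seq bool) : 'M[int]_2 := \prod_(b <- s) simple_refl b.

Definition weyl (w : 'M[int]_2) := exists s, w = weyl_word s.

Definition weyl_length (w : 'M[int]_2) : nat :=
  nat_min [set n | exists2 s, size s = n & w = weyl_word s]%classic.

Definition dot_action (w : 'M[int]_2) (l : 'cV[int]_2) := w *m (l + rho) - rho.

(* The weight (a, b) of GL2 is a (alpha + beta) + b alpha. *)
Definition levi_weight (ab : int * int) : 'cV[int]_2 :=
  ab.1 *: (sroot_alpha + sroot_beta) + ab.2 *: sroot_alpha.

Variables (R : realType) (F : fieldExtType rat).
Implicit Types w : emb R F -> 'M[int]_2.

Definition kostant_rep w :=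
  forall eta, weyl (w eta) /\ invmx (w eta) *m sroot_beta \in pos_roots.

Definition balanced w := forall eta,
  (weyl_length (w eta) + weyl_length (w (conj_emb eta)) = 5)%N.

Definition inv_dot_dominant w (mu : emb R F -> int * int) := forall eta,
  dominant (dot_action (invmx (w eta)) (levi_weight (mu eta))).

End G2.

Section Archimedean.
Variables (R : realType) (F : fieldExtType rat).

(* If F is totally imaginary, a place is a conjugate pair of embeddings; it is
   represented by the embedding enumerated first. *)
Definition place :=
  {eta : emb R F | (enum_rank eta < enum_rank (conj_emb eta))%N}.

(* (p, q) with p - q an integer stands for the quasi-character
   z |-> z^p zbar^q = z^(p - q) |z|^(2 q) of C^x, so that the group law on
   quasi-characters is written additively. *)
Definition qchar := (R * R)%type.

Definition qchar_eval (chi : qchar) (z : R[i]) : R[i] :=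
  z ^ Num.floor (chi.1 - chi.2) * ((complex.Re `|z|) `^ (2 * chi.2))%:C.

(* Gauss' formula for the entire function 1 / Gamma, on the real line. *)
Definition recip_Gamma (x : R) : R :=
  limn (fun n => (\prod_(k < n.+1) (x + k%:R)) / (n`!%:R * n%:R `^ x)).

(* Gamma_C(s) = 2 (2 pi)^(-s) Gamma(s) *)
Definition recip_GammaC (s : R) : R := (2 * pi) `^ s / 2 * recip_Gamma s.

(* A Langlands parameter C^x -> GL_n(C) at every place, as a sum of
   quasi-characters. *)
Definition lparam := place -> seq qchar.

Definition dual_lparam (phi : lparam) : lparam :=
  fun v => [seq - chi | chi <- phi v].

(* 1 / L_oo(s, phi), with L(s, z^p zbar^q) = Gamma_C(s + max(p, q)). *)
Definition recip_Linf (phi : lparam) (s : R) : R :=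
  \prod_(v : place) \prod_(chi <- phi v) recip_GammaC (s + Num.max chi.1 chi.2).

(* Gamma has no zero, so 1 / L_oo is entire and the poles of L_oo are the zeros
   of 1 / L_oo. *)
Definition Linf_finite (phi : lparam) (s : R) := recip_Linf phi s <> 0.

Definition critical (phi : lparam) (s : R) :=
  Linf_finite phi s /\ Linf_finite (dual_lparam phi) (1 - s).

Definition critical_half_integer (phi : lparam) (s : R) :=
  s - 1 / 2 \is a Num.int /\ critical phi s.

Definition critical_integer (phi : lparam) (s : R) :=
  s \is a Num.int /\ critical phi s.

End Archimedean.

(* The adele ring of F is F_oo x A_f.  The finite adeles A_f are the completion
   of F for the topology having the n O_F, n > 0, as a basis of neighbourhoods
   of 0: a matrix over A_f is represented by a Cauchy sequence of matrices over
   F, two sequences being identified if their difference tends to 0. *)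
Section Adeles.
Variables (R : realType) (F : fieldExtType rat).

Definition Mf := nat -> 'M[F]_2.
Definition Minf := place R F -> 'M[R[i]]_2.

Definition in_OF (x : F) := integralOver (intr : int -> F) x.

Definition congr0_mx (n : nat) (A : 'M[F]_2) := forall i j, in_OF (A i j / n%:R).

Definition cauchy_mx (g : Mf) := forall n, (0 < n)%N ->
  exists K, forall k l, (K <= k)%N -> (K <= l)%N -> congr0_mx n (g k - g l).

Definition null_mx (g : Mf) := forall n, (0 < n)%N ->
  exists K, forall k, (K <= k)%N -> congr0_mx n (g k).

Definition same_mx (g h : Mf) := null_mx (fun k => g k - h k).

Definition mul_mxf (g h : Mf) : Mf := fun k => g k *m h k.

Definition inverse_mxf (g h : Mf) :=
  [/\ cauchy_mx g, cauchy_mx h, same_mx (mul_mxf g h) (fun=> 1%:M)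
    & same_mx (mul_mxf h g) (fun=> 1%:M)].

Definition GLf (g : Mf) := exists h, inverse_mxf g h.

(* The open compact subgroup of matrices of GL_2(O_F^) congruent to 1 mod n. *)
Definition congr_subgroup (n : nat) (g : Mf) :=
  exists2 h, inverse_mxf g h &
  exists K, forall k, (K <= k)%N ->
    congr0_mx n (g k - 1%:M) /\ congr0_mx n (h k - 1%:M).

Definition GLinf (g : Minf) := forall v, g v \in unitmx.
Definition mul_mxi (g h : Minf) : Minf := fun v => g v *m h v.
Definition Kinf (k : Minf) := forall v, k v *m (map_mx conjc (k v))^T = 1%:M.

Definition diag_inf (A : 'M[F]_2) : Minf := fun v => map_mx (val v) A.

Definition unipotent (A : nzRingType) (x : A) : 'M[A]_2 :=
  1%:M + x *: delta_mx 0 1.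

End Adeles.

Section Automorphic.
Variables (R : realType) (F : fieldExtType rat).
Notation C := R[i].
Notation Minf := (Minf R F).
Notation Mf := (Mf F).
Notation place := (place R F).

Definition continuous_GLinf (f : Minf -> C) :=
  forall g, GLinf g -> forall e : R, 0 < e -> exists2 d : R, 0 < d &
  forall h, GLinf h -> (forall v i j, `|h v i j - g v i j| < d%:C) ->
    `|f h - f g| < e%:C.

Definition along (f : Minf -> C) (g Y : Minf) (t : R) : C :=
  f (fun v => g v + t%:C *: Y v).

Definition derivable_along f g Y :=
  derivable (fun t : R => complex.Re (along f g Y t)) 0 1 /\
  derivable (fun t : R => complex.Im (along f g Y t)) 0 1.

Definition derive_along (Y : Minf) (f : Minf -> C) (g : Minf) : C :=
  derive1 (fun t : R => complex.Re (along f g Y t)) 0 +i*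
  derive1 (fun t : R => complex.Im (along f g Y t)) 0.

Fixpoint Cn_GLinf (n : nat) (f : Minf -> C) : Prop :=
  continuous_GLinf f /\
  if n is n'.+1 then forall Y,
    (forall g, GLinf g -> derivable_along f g Y) /\ Cn_GLinf n' (derive_along Y f)
  else True.

Definition smooth_GLinf f := forall n, Cn_GLinf n f.

(* d/dt f(g exp(tX)) at t = 0 *)
Definition lie_derive (X : Minf) (f : Minf -> C) : Minf -> C :=
  fun g => derive_along (mul_mxi g X) f g.

(* K_oo-finite functions in the representation of GL_2(F_oo) induced, with
   normalization by delta_B^(1/2) = |a / d| at every place, from the characters
   chi_1(a) chi_2(d) of the upper triangular Borel subgroup. *)
Definition principal_series (chi : place -> qchar R * qchar R) (f : Minf -> C) :=
  [/\ forall g, ~ GLinf g -> f g = 0,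
      smooth_GLinf f,
      exists n (e : 'I_n -> Minf -> C), forall k, Kinf k ->
        exists c : 'I_n -> C, forall g, f (mul_mxi g k) = \sum_i c i * e i g
    & forall b g, GLinf b -> (forall v, b v 1 0 = 0) -> GLinf g ->
      f (mul_mxi b g) =
      (\prod_v (qchar_eval (chi v).1 (b v 0 0) * qchar_eval (chi v).2 (b v 1 1)
                * `|b v 0 0 / b v 1 1|)) * f g].

Implicit Types phi : Minf -> Mf -> C.

Definition eq_GL2A phi phi' :=
  forall g gf, GLinf g -> GLf gf -> phi g gf = phi' g gf.

Definition lie_deriveA X phi : Minf -> Mf -> C :=
  fun g gf => lie_derive X (phi^~ gf) g.

Definition at_place (v : place) (A : 'M[C]_2) : Minf :=
  fun u => if u == v then A else 0.

(* gl_2(C) (x)_R C = gl_2(C) + gl_2(C) acts through the holomorphic (s = 1) and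
   antiholomorphic (s = -1) parts of the Lie derivatives. *)
Definition lie_part (s : C) v (A : 'M[C]_2) phi : Minf -> Mf -> C :=
  fun g gf => (lie_deriveA (at_place v A) phi g gf
               - s * 'i * lie_deriveA (at_place v ('i *: A)) phi g gf) / 2.

(* For each gl_2, the trace element and the Casimir element generate the centre
   of the universal enveloping algebra. *)
Definition trace_op s v phi := lie_part s v 1%:M phi.
Definition casimir_op s v phi : Minf -> Mf -> C := fun g gf =>
  \sum_i \sum_j lie_part s v (delta_mx i j) (lie_part s v (delta_mx j i) phi) g gf.

Definition in_span n (e : 'I_n -> Minf -> Mf -> C) phi :=
  exists c : 'I_n -> C, eq_GL2A phi (fun g gf => \sum_i c i * e i g gf).

Definition center_finite phi :=
  exists n (e : 'I_n -> Minf -> Mf -> C), in_span e phi /\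
  forall i, (forall gf, GLf gf -> smooth_GLinf (e i ^~ gf)) /\
    forall s v, s \in [:: 1; -1] ->
      in_span e (trace_op s v (e i)) /\ in_span e (casimir_op s v (e i)).

Definition K_finite phi :=
  exists n (e : 'I_n -> Minf -> Mf -> C), forall k, Kinf k ->
    in_span e (fun g gf => phi (mul_mxi g k) gf).

Definition height_inf (g : Minf) : C :=
  \sum_v (\sum_i \sum_j `|g v i j| + `|\det (g v)|^-1).

Definition moderate_growth (f : Minf -> C) :=
  exists (c : C) N, forall g, GLinf g -> `|f g| <= c * height_inf g ^+ N.

Definition automorphic_form phi :=
  [/\ forall g gf gf', GLinf g -> GLf gf -> GLf gf' -> same_mx gf gf' ->
        phi g gf = phi g gf',
      forall A : 'M[F]_2, A \in unitmx ->
        eq_GL2A (fun g gf => phi (mul_mxi (diag_inf A) g) (mul_mxf (fun=> A) gf)) phi,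
      exists2 n, (0 < n)%N & forall k, congr_subgroup n k ->
        eq_GL2A (fun g gf => phi g (mul_mxf gf k)) phi,
      K_finite phi /\ center_finite phi
    & forall gf, GLf gf -> smooth_GLinf (phi^~ gf) /\ moderate_growth (phi^~ gf)].

Fixpoint cube_integral (d : nat) (f : seq R -> R) : R :=
  if d is d'.+1 then
    Rintegral lebesgue_measure `[0, 1]%classic
      (fun t => cube_integral d' (fun s => f (t :: s)))
  else f [::].

Definition cube_integralC d (f : seq R -> C) : C :=
  cube_integral d (fun s => complex.Re (f s)) +i*
  cube_integral d (fun s => complex.Im (f s)).

Definition integral_basis d (e : 'I_d -> F) := d = \dim (@fullv _ F) /\
  forall x, in_OF x <-> exists c : 'I_d -> int, x = \sum_i (c i)%:~R * e i.

(* The constant term along the unipotent radical N of the Borel subgroup.  If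
   x |-> phi(n(x) g) is invariant under m O_F^ then, since A_F = F + F_oo x m O_F^,
   its integral over F \ A_F is, up to a positive constant, the integral over a
   fundamental domain of the lattice m O_F in F_oo. *)
Definition cuspidal_form phi :=
  forall g gf m d (e : 'I_d -> F), GLinf g -> GLf gf -> (0 < m)%N ->
  integral_basis e ->
  (forall (x : nat -> F) h, (forall k, in_OF (x k)) ->
     cauchy_mx (fun k => unipotent (x k)) -> GLinf h ->
     phi h (mul_mxf (fun k => unipotent (m%:R * x k)) gf) = phi h gf) ->
  cube_integralC d (fun t =>
    phi (mul_mxi (fun v => unipotent
                   (\sum_(i < d) (nth 0 t i)%:C * val v (m%:R * e i))) g) gf) = 0.

Definition cusp_form phi := automorphic_form phi /\ cuspidal_form phi.

Record fin_rep := FinRep {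
  fin_space : lmodType C;
  fin_act : Mf -> fin_space -> fin_space
}.

Definition smooth_irreducible (pi : fin_rep) :=
  let V := fin_space pi in let act := @fin_act pi in
  [/\ [/\ forall g a (x y : V), GLf g -> act g (a *: x + y) = a *: act g x + act g y,
          forall x, act (fun=> 1%:M) x = x,
          forall g h x, GLf g -> GLf h -> act (mul_mxf g h) x = act g (act h x)
        & forall g h x, GLf g -> GLf h -> same_mx g h -> act g x = act h x],
      forall x, exists2 n, (0 < n)%N & forall k, congr_subgroup n k -> act k x = x,
      exists x : V, x <> 0
    & forall P : V -> Prop, P 0 ->
        (forall a x y, P x -> P y -> P (a *: x + y)) ->
        (forall g x, GLf g -> P x -> P (act g x)) ->
        (forall x, P x) \/ (forall x, P x -> x = 0)].

(* sigma = sigma_f (x) sigma_oo, where sigma_oo is given by its inducing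
   characters. *)
Record aut_rep := AutRep {
  fin_part : fin_rep;
  inf_part : place -> qchar R * qchar R
}.

(* sigma_oo being irreducible, sigma is a cuspidal automorphic representation iff
   there is a nonzero GL_2(A_f) x (g_oo, K_oo)-equivariant map T from
   sigma_f (x) sigma_oo to the space of cusp forms. *)
Definition cuspidal_rep (sigma : aut_rep) :=
  let pi := fin_part sigma in let ps := principal_series (inf_part sigma) in
  smooth_irreducible pi /\
  exists T : fin_space pi -> (Minf -> C) -> Minf -> Mf -> C,
  [/\ forall x f, ps f -> cusp_form (T x f),
      (forall a x y f, ps f ->
         eq_GL2A (T (a *: x + y) f) (fun g gf => a * T x f g gf + T y f g gf)) /\
      (forall a x f f', ps f -> ps f' ->
         eq_GL2A (T x (fun g => a * f g + f' g))
                 (fun g gf => a * T x f g gf + T x f' g gf)),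
      forall h x f, GLf h -> ps f ->
        eq_GL2A (T (fin_act h x) f) (fun g gf => T x f g (mul_mxf gf h)),
      (forall k x f, Kinf k -> ps f ->
         eq_GL2A (T x (fun g => f (mul_mxi g k))) (fun g gf => T x f (mul_mxi g k) gf)) /\
      (forall X x f, ps f ->
         eq_GL2A (T x (lie_derive X f)) (lie_deriveA X (T x f)))
    & exists x f g gf, [/\ ps f, GLinf g, GLf gf & T x f g gf <> 0]].

(* J_mu: the irreducible principal series of GL_2(F_oo) which, among the
   archimedean components of cuspidal representations, is the one having
   cohomology with coefficients in the local system of highest weight mu. *)
Definition J_mu (mu : emb R F -> int * int) (v : place) : qchar R * qchar R :=
  let: (a, b) := mu (val v) in let: (a', b') := mu (conj_emb (val v)) in
  ((- b%:~R + 1 / 2, - a'%:~R - 1 / 2), (- a%:~R - 1 / 2, - b'%:~R + 1 / 2)).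

Definition Coh (mu : emb R F -> int * int) (sigma_f : fin_rep) :=
  cuspidal_rep (AutRep sigma_f (J_mu mu)).

(* The Langlands parameter of Ind(chi_1, chi_2) is chi_1 + chi_2, and exponents
   of quasi-characters add. *)
Definition sym3 (chi : qchar R * qchar R) : seq (qchar R) :=
  [:: chi.1 *+ 3; chi.1 *+ 2 + chi.2; chi.1 + chi.2 *+ 2; chi.2 *+ 3].

Definition central_lparam (sigma : aut_rep) : lparam R F :=
  fun v => [:: (inf_part sigma v).1 + (inf_part sigma v).2].

Definition Ad3_lparam (sigma : aut_rep) : lparam R F :=
  fun v => [seq chi - omega | chi <- sym3 (inf_part sigma v),
                              omega <- central_lparam sigma v].

End Automorphic.

(* Main.v *)
(* Purity gives mu at the conjugate embedding as (w - b, w - a), so every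
   exponent pair (p, q) of Ad^3 at infinity has p + q = -w, that of the central
   character has p + q = -2 w, and the differences p - q are the quantities whose
   absolute values are minimized in l_1 and (doubled) in l_2.  Since 1/Gamma
   vanishes at the integers <= 0 only, s is critical iff exactly one of s + p and
   s + q is positive for each pair; at the four given points this says that
   |w + 5| + 2 bounds the differences of l_1 and |w + 5| + 1 those of l_2.  The
   same inequalities locate mu + rho and its conjugate in opposite Weyl chambers
   (the k-th and the (5 - k)-th) among the six on which beta is positive. *)
From HB Require Import structures.
Require Import Defs.
From mathcomp Require Import all_boot all_order all_algebra all_field.
From mathcomp Require Import complex.
From mathcomp Require Import all_classical all_reals all_analysis.
From mathcomp Require Import zify ring.

Set Implicit Arguments.
Unset Strict Implicit.
Unset Printing Implicit Defensive.

Import Order.TTheory GRing.Theory Num.Theory.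
Import numFieldNormedType.Exports.

Local Open Scope ring_scope.

(** * Embeddings of a number field into an algebraically closed field *)

Lemma number_field_primitive (F : fieldExtType rat) :
  exists z : F, forall x, exists p : {poly rat}, (map_poly (in_alg F) p).[z] = x.
Proof.
have F0 : [pchar F] =i pred0 by move=> p; rewrite pchar_lalg pchar_num.
have sepF : separable 1%AS {:F}%AS.
  by apply/separableP => x _; apply: pcharf0_separable.
exists (separable_generator 1%AS {:F}%AS) => x.
have : x \in <<1%AS; separable_generator 1%AS {:F}%AS>>%VS.
  by rewrite -eq_adjoin_separable_generator ?sub1v ?memvf.
by case/Fadjoin_polyP => _ /polyOver1P[p ->] ->; exists p.
Qed.

(** A generator [z] goes to a root [c] of its minimal polynomial; this is well defined because
    polynomials agreeing at [z] differ by a multiple of that polynomial. It ensures that the minima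
    [ell1] and [ell2] are over nonempty sets. *)
Lemma number_field_embedding (K : numClosedFieldType) (F : fieldExtType rat) :
  inhabited {rmorphism F -> K}.
Proof.
have [z /choice[P zP]] := number_field_primitive F.
have /polyOver1P[m mE] := minPolyOver 1%AS z.
have [c /rootP mc] : exists c, root (map_poly ratr m : {poly K}) c.
  apply/closed_rootP; rewrite size_map_poly -(size_map_poly (in_alg F)) -mE.
  by rewrite size_minPoly.
pose ev (p : {poly rat}) := (map_poly ratr p : {poly K}).[c].
have ev_eq (p q : {poly rat}) :
    (map_poly (in_alg F) p).[z] = (map_poly (in_alg F) q).[z] -> ev p = ev q.
  move=> pq; have : minPoly 1%AS z %| map_poly (in_alg F) (p - q).
    by rewrite minPoly_dvdp ?alg_polyOver // rootE rmorphB hornerD hornerN pq subrr.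
  rewrite mE dvdp_map => /dvdpP[r pqE]; apply/eqP; rewrite -subr_eq0 /ev.
  by rewrite -hornerN -hornerD -rmorphB pqE rmorphM hornerM mc mulr0.
pose f x := ev (P x).
have fB : zmod_morphism f.
  move=> x y; rewrite /f /ev -hornerN -hornerD -rmorphB; apply: ev_eq.
  by rewrite rmorphB hornerD hornerN !zP.
have fM : monoid_morphism f.
  split=> [|x y]; rewrite /f.
    have <- : ev 1 = 1 by rewrite /ev rmorph1 hornerC.
    by apply: ev_eq; rewrite rmorph1 hornerC zP.
  by rewrite /ev -hornerM -rmorphM; apply: ev_eq; rewrite rmorphM hornerM !zP.
pose fBm := GRing.isZmodMorphism.Build _ _ f fB.
pose fMm := GRing.isMonoidMorphism.Build _ _ f fM.
pose fR : {rmorphism F -> K} := HB.pack f fBm fMm.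
by constructor.
Qed.

(** * Complex conjugation, purity and places *)

Section Embeddings.
Variables (R : realType) (F : fieldExtType rat).
Implicit Types (eta : emb R F) (mu : emb R F -> int * int).

Lemma conj_embK : involutive (@conj_emb R F).
Proof. by move=> eta; apply: embP => x /=; rewrite conjcK. Qed.

(** Purity with the identity as Galois element, at [eta] and at its conjugate, yields one coordinate
    each. *)
Lemma strongly_pure_conj mu w : strongly_pure mu w -> forall eta,
  mu (conj_emb eta) = (w - (mu eta).2, w - (mu eta).1).
Proof.
move=> mu_pure eta.
have id_emb e : gal_emb (idfun : {rmorphism Qbar R -> Qbar R}) e = e.
  exact: embP.
have pure e : (mu e).1 + (mu (conj_emb e)).2 = w.
  have := @mu_pure idfun idfun (fun=> erefl) (fun=> erefl) e.
  by rewrite !id_emb.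
have := pure eta; have := pure (conj_emb eta); rewrite conj_embK.
case: (mu (conj_emb eta)) => a b /= aw bw.
by congr pair; [rewrite -aw|rewrite -bw]; ring.
Qed.

Lemma place_or_conj : totally_imaginary R F -> forall eta,
  exists v : place R F, val v = eta \/ val v = conj_emb eta.
Proof.
move=> F_imag eta.
case: (ltngtP (enum_rank eta) (enum_rank (conj_emb eta))) => [lt|gt|eq].
- by exists (Sub eta lt); left.
- have lt : (enum_rank (conj_emb eta) < enum_rank (conj_emb (conj_emb eta)))%N.
    by rewrite conj_embK.
  by exists (Sub (conj_emb eta) lt); right.
- by case: (F_imag eta); apply/esym/enum_rank_inj/val_inj.
Qed.

End Embeddings.

(** * Values of 1/Gamma at the integers *)

Section Gamma.
Local Open Scope classical_set_scope.
Variable R : realType.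

Definition gauss_seq (x : R) (n : nat) : R :=
  (\prod_(k < n.+1) (x + k%:R)) / (n`!%:R * n%:R `^ x).

(** From index [m] on, Gauss' product contains the factor -m + m = 0. *)
Lemma recip_Gamma_nonpos (m : nat) : recip_Gamma (- m%:R : R) = 0.
Proof.
apply/cvg_lim => //; apply: cvg_near_cst; exists m => // n /= mn.
have mn1 : (m < n.+1)%N by rewrite ltnS.
by rewrite (bigD1 (Ordinal mn1)) //= addNr !mul0r.
Qed.

(** The functional equation Gamma(x + 1) = x Gamma(x) at finite level, up to a factor tending to 1;
    it drives the induction computing the limit at positive integers. *)
Lemma gauss_seqS (x : R) n : 0 < x ->
  gauss_seq (x + 1) n.+1 =
  gauss_seq x n.+1 * (1 + (x + 1) * n.+1%:R^-1) / x.
Proof.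
move=> x0; rewrite /gauss_seq.
have -> : \prod_(k < n.+2) (x + 1 + k%:R) =
          (\prod_(k < n.+2) (x + k%:R)) * (x + n.+2%:R) / x.
  rewrite [in LHS]big_ord_recr [in RHS]big_ord_recl /= addr0.
  under eq_bigr => i _ do rewrite -addrA nat1r.
  rewrite -addrA nat1r; field; exact: lt0r_neq0.
have n0 : n.+1%:R `^ x != 0 :> R by rewrite gt_eqF ?powR_gt0.
rewrite powRD ?pnatr_eq0 ?implybT// powRr1// -[n.+2]addn1 natrD.
field; rewrite n0 (lt0r_neq0 x0) pnatr_eq0 -lt0n fact_gt0 /=.
by rewrite nat1r pnatr_eq0.
Qed.

Lemma gauss_seq1 n : gauss_seq 1 n.+1 = 1 + n.+1%:R^-1.
Proof.
have prodE m : \prod_(k < m) (1 + k%:R) = m`!%:R :> R.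
  elim: m => [|m IH]; first by rewrite big_ord0.
  by rewrite big_ord_recr /= IH nat1r -natrM mulnC -factS.
rewrite /gauss_seq prodE powRr1 // factS natrM -[n.+2]addn1 natrD.
field; rewrite nat1r pnatr_eq0 /= pnatr_eq0 -lt0n fact_gt0 //.
Qed.

Lemma gauss_seq_cvg (m : nat) :
  gauss_seq m.+1%:R n @[n --> \oo] --> (m`!%:R^-1 : R).
Proof.
have cvg1 (c : R) : (1 + c * n.+1%:R^-1) @[n --> \oo] --> (1 : R).
  rewrite -[X in _ --> X]addr0 -[X in _ --> _ + X](mulr0 c).
  apply: cvgD; first exact: cvg_cst.
  by apply: cvgM; [exact: cvg_cst|exact: cvg_harmonic].
elim: m => [|m IH]; rewrite -cvg_shiftS /=.
  under eq_fun => n do rewrite gauss_seq1 -[_^-1]mul1r.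
  by rewrite invr1; exact: cvg1.
under eq_fun => n do rewrite -natr1 gauss_seqS //.
rewrite factS natrM invfM mulrC -[X in X * _]mulr1.
apply: cvgM; last exact: cvg_cst.
by apply: cvgM; [rewrite -cvg_shiftS in IH|exact: cvg1].
Qed.

Lemma recip_Gamma_pos (m : nat) : recip_Gamma (m.+1%:R : R) = m`!%:R^-1.
Proof. by apply/cvg_lim => //; exact: gauss_seq_cvg. Qed.

Lemma recip_GammaC_int (s : R) : s \is a Num.int ->
  (recip_GammaC s != 0) = (0 < s).
Proof.
have pi2 z : (2 * pi) `^ z / 2 != 0 :> R.
  by rewrite mulf_neq0 ?invr_eq0 ?pnatr_eq0// gt_eqF ?powR_gt0 ?mulr_gt0 ?pi_gt0.
rewrite intrE => /orP[|] /natrP[m sE].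
  rewrite sE /recip_GammaC mulf_eq0 (negPf (pi2 _)) /=.
  case: m {sE} => [|m].
    by have := recip_Gamma_nonpos 0; rewrite oppr0 => ->; rewrite eqxx ltxx.
  by rewrite recip_Gamma_pos invr_eq0 pnatr_eq0 -lt0n fact_gt0 ltr0Sn.
rewrite -[s]opprK sE /recip_GammaC recip_Gamma_nonpos mulr0 eqxx.
by rewrite oppr_gt0 ltrn0.
Qed.
End Gamma.

(** * Criticality as a sign condition *)

Section Critical.
Variables (R : realType) (F : fieldExtType rat).
Implicit Types (phi : lparam R F) (s : R) (eta : emb R F).

Lemma Linf_finite_int phi s :
  (forall v chi, chi \in phi v -> s + Num.max chi.1 chi.2 \is a Num.int) ->
  Linf_finite phi s <->
  forall v chi, chi \in phi v -> 0 < s + Num.max chi.1 chi.2.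
Proof.
move=> phi_int; rewrite /Linf_finite /recip_Linf; split=> [/eqP|phi_pos].
  rewrite prodf_seq_neq0 => /allP L0 v chi chi_v.
  have := L0 v (mem_index_enum _); rewrite /= prodf_seq_neq0.
  by move=> /allP/(_ _ chi_v); rewrite /= recip_GammaC_int //; exact: phi_int chi_v.
apply/eqP; rewrite prodf_seq_neq0; apply/allP => v _ /=.
rewrite prodf_seq_neq0; apply/allP => chi chi_v /=.
by rewrite recip_GammaC_int; [exact: phi_pos chi_v|exact: phi_int chi_v].
Qed.

Lemma critical_int phi s :
  (forall v chi, chi \in phi v -> s + chi.1 \is a Num.int /\ s + chi.2 \is a Num.int) ->
  critical phi s <->
  forall v chi, chi \in phi v -> (0 < s + chi.1) != (0 < s + chi.2).
Proof.
move=> phi_int.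
have max_int (x y z : R) : x + y \is a Num.int -> x + z \is a Num.int ->
    x + Num.max y z \is a Num.int by move=> xy xz; case: leP.
have int1 (x y : R) : x + y \is a Num.int -> 1 - x - y \is a Num.int.
  by move=> xy; rewrite -addrA -opprD; apply: rpredB => //; exact: rpred1.
have sign_int (x : R) : x \is a Num.int -> (0 < 1 - x) = ~~ (0 < x).
  by case/intrP => m ->; rewrite -[1]/(1%:~R) -intrB !ltr0z; lia.
(* One of s + x, s + y must be positive and, as 1 - z > 0 iff z <= 0 for an integer z, one must be
   nonpositive: their signs differ. *)
have crit_max (x y : R) : s + x \is a Num.int -> s + y \is a Num.int ->
    (0 < s + x) != (0 < s + y) =
    (0 < s + Num.max x y) && (0 < 1 - s + Num.max (- x) (- y)).
  move=> sx sy; rewrite !addr_maxr !lt_max -!addrA -!opprD !sign_int //.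
  by case: (0 < s + x); case: (0 < s + y).
rewrite /critical !Linf_finite_int.
- split=> [[pos neg] v chi chi_v|crit].
    have [s1 s2] := phi_int v chi chi_v.
    rewrite crit_max // (pos v chi chi_v) /=; apply: (neg v (- chi)).
    by rewrite /dual_lparam map_f.
  split=> v chi; last case/mapP=> {}chi + ->; move=> chi_v;
  have [s1 s2] := phi_int v chi chi_v; have := crit v chi chi_v;
  by rewrite crit_max // => /andP[].
- move=> v _ /mapP[chi chi_v ->]; have [s1 s2] := phi_int v chi chi_v.
  by rewrite max_int //= int1.
- by move=> v chi /phi_int[s1 s2]; exact: max_int.
Qed.
End Critical.

(** * Minima of sets of natural numbers *)

Lemma nat_min_ge (A : set nat) n : (exists m, A m) ->
  (n <= nat_min A)%N <-> forall m, A m -> (n <= m)%N.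
Proof.
case=> m0 Am0; rewrite /nat_min.
have /cid[m [Am m_min]] : exists m, A m /\ forall k, A k -> (m <= k)%N.
  have exA : exists k, `[< A k >] by exists m0; apply/asboolP.
  case: (ex_minnP exA) => m /asboolP Am m_min; exists m; split=> // k Ak.
  by apply: m_min; apply/asboolP.
case: xgetP => [_ -> [{}Am {}m_min]|/(_ m)[]//]; split=> [nm k /m_min|/(_ _ Am)//].
exact: leq_trans.
Qed.

Lemma nat_minE (A : set nat) n : A n -> (forall m, A m -> (n <= m)%N) -> nat_min A = n.
Proof.
move=> An n_min; have exA : exists m, A m by exists n.
apply/eqP; rewrite eqn_leq (nat_min_ge _ exA).2 // andbT.
by apply: (nat_min_ge _ exA).1.
Qed.

(** * The Weyl group of G2, its Kostant representatives and their chambers *)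

Section RootSystem.

(** The simple reflections in coordinates along alpha and beta: a computable model of the matrices,
    so that [vm_compute] can settle statements on the finite Weyl group. *)
Definition refl_pair (b : bool) (p : int * int) : int * int :=
  if b then (p.1, p.1 - p.2) else (3 * p.2 - p.1, p.2).

Definition word_pair (s : seq bool) (p : int * int) := foldr refl_pair p s.

Lemma weyl_word_cons b s : weyl_word (b :: s) = simple_refl b *m weyl_word s.
Proof. by rewrite /weyl_word big_cons. Qed.

Lemma simple_refl_wt b p :
  simple_refl b *m wt p.1 p.2 = wt (refl_pair b p).1 (refl_pair b p).2.
Proof.
apply/colP => i; rewrite /simple_refl.
case: b; rewrite mulmxBl mul1mx -mulmxA !mxE big_ord1 !mxE big_ord_recl big_ord1 !mxE;
case: i => [[|[|//]] ?] /=; lia.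
Qed.

Lemma word_pair_correct s p :
  weyl_word s *m wt p.1 p.2 = wt (word_pair s p).1 (word_pair s p).2.
Proof.
elim: s => [|b s IH]; first by rewrite /weyl_word big_nil mul1mx.
by rewrite weyl_word_cons -mulmxA IH simple_refl_wt.
Qed.

Lemma wt_inj x y x' y' : wt x y = wt x' y' -> (x, y) = (x', y').
Proof. by move/colP => e; have := e 0; have := e 1; rewrite !mxE /= => -> ->. Qed.

Definition word_basis s := (word_pair s (1, 0), word_pair s (0, 1)).

Lemma weyl_word_eqP s t : weyl_word s = weyl_word t <-> word_basis s = word_basis t.
Proof.
split=> [st|[e1 e2]].
  have st_pair p : word_pair s p = word_pair t p.
    have := word_pair_correct s p; rewrite st word_pair_correct => /wt_inj.
    by rewrite -!surjective_pairing.
  by rewrite /word_basis !st_pair.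
have col_wt (A : 'M[int]_2) j : col j A = A *m wt (j == 0) (j == 1).
  rewrite colE; congr mulmx; apply/colP => i; rewrite !mxE.
  by case: i j => [[|[|//]] ?] [[|[|//]] ?].
apply/matrixP => i j; have /colP/(_ i) : col j (weyl_word s) = col j (weyl_word t).
  rewrite !col_wt; have := word_pair_correct s (j == 0 : int, j == 1 : int).
  rewrite /= => ->; have -> := word_pair_correct t (j == 0 : int, j == 1 : int).
  case: j => [[|[|//]] ?] /=; rewrite /eq_op /=.
    by rewrite e1.
  by rewrite e2.
by rewrite !mxE.
Qed.

(* One reduced word for each of the 12 elements of the Weyl group. *)
Definition reduced_words : seq (seq bool) :=
  [:: [::]; mkseq odd 6] ++
  [seq mkseq (fun i => odd (i + c)) n | c <- [:: 0; 1]%N, n <- iota 1 5].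

(** Induction on the word: up to equality in the group, the list is closed under left multiplication
    by a simple reflection, with length growing by at most one; this is a finite check. *)
Lemma weyl_word_reduced s : exists2 t, t \in reduced_words &
  weyl_word s = weyl_word t /\ (size t <= size s)%N.
Proof.
elim: s => [|b s [t t_red [st szt]]]; first by exists [::].
have : all (fun b => all (fun t => has (fun t' =>
    (word_basis t' == word_basis (b :: t)) && (size t' <= (size t).+1)%N)
    reduced_words) reduced_words) [:: true; false].
  by vm_compute.
move=> /allP/(_ b); rewrite !inE; case: b => /(_ isT)/allP/(_ t t_red)/hasP;
case=> t' t'_red /andP[/eqP/weyl_word_eqP tt' szt']; exists t' => //;
by rewrite tt' !weyl_word_cons st; split=> //; exact: leq_trans szt' _.
Qed.

(** Any word for the element can be replaced by a listed one that is no longer, and listed words of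
    the same element have equal length. *)
Lemma weyl_length_reduced t : t \in reduced_words ->
  weyl_length (weyl_word t) = size t.
Proof.
move=> t_red; apply: nat_minE; first by exists t.
move=> n [s <- ts]; have [t' t'_red [st' szt']] := weyl_word_reduced s.
have : all (fun t => all (fun t' => (word_basis t == word_basis t') ==>
    (size t == size t')) reduced_words) reduced_words.
  by vm_compute.
move=> /allP/(_ t t_red)/allP/(_ t' t'_red); suff -> : word_basis t == word_basis t'.
  by move=> /eqP ->.
by apply/eqP/weyl_word_eqP; rewrite -st'.
Qed.

Lemma invmx_weyl_word s : invmx (weyl_word s) = weyl_word (rev s).
Proof.
have reflK b : simple_refl b *m simple_refl b = 1%:M.
  have -> : simple_refl b *m simple_refl b = weyl_word [:: b; b].
    by rewrite !weyl_word_cons /weyl_word big_nil mulmx1.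
  have -> : 1%:M = weyl_word [::] by rewrite /weyl_word big_nil.
  by apply/weyl_word_eqP; case: b; vm_compute.
have wordK : weyl_word s *m weyl_word (rev s) = 1%:M.
  elim: s => [|b s IH]; first by rewrite /weyl_word big_nil mulmx1.
  rewrite weyl_word_cons rev_cons /weyl_word big_rcons /= -mulmxA.
  by rewrite [X in _ *m X]mulmxA IH mul1mx reflK.
by rewrite -[RHS]mul1mx -(mulVmx (mulmx1_unit wordK).1) -mulmxA wordK mulmx1.
Qed.

Lemma dominant_wt x y : dominant (wt x y) <-> 3 * y <= 2 * x /\ x <= 2 * y.
Proof.
rewrite /dominant !mxE !big_ord_recl !big_ord0 !mxE /=; split=> -[]; lia.
Qed.

(** The shifts by 5 and 3 are the coordinates of [rho]; [levi_weight (a, b)] has coordinates (a + b,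
    a). *)
Lemma dot_action_word s ab : dominant (dot_action (weyl_word s) (levi_weight ab)) <->
  let p := word_pair s (ab.1 + ab.2 + 5, ab.1 + 3) in
  3 * (p.2 - 3) <= 2 * (p.1 - 5) /\ p.1 - 5 <= 2 * (p.2 - 3).
Proof.
rewrite /dot_action; set l := (ab.1 + ab.2 + 5, ab.1 + 3).
have -> : levi_weight ab + rho = wt l.1 l.2.
  by apply/colP => -[[|[|//]] ?]; rewrite !mxE /=; lia.
rewrite word_pair_correct -dominant_wt.
set p := word_pair s l.
suff -> : wt p.1 p.2 - rho = wt (p.1 - 5) (p.2 - 3) by [].
by apply/colP => -[[|[|//]] ?]; rewrite !mxE.
Qed.

(* Since [odd 0 = false], the letters alternate starting with the reflection in
   [alpha]. *)
Definition kostant_word n := mkseq odd n.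

(** The inverse of w keeps beta positive iff no reduced word of w starts with the reflection in
    beta. This excludes the longest element, which has reduced words starting with either
    reflection. *)
Lemma kostant_words s : s \in reduced_words ->
  (invmx (weyl_word s) *m sroot_beta \in pos_roots) =
  (s \in [seq kostant_word n | n <- iota 0 6]).
Proof.
move=> s_red; rewrite invmx_weyl_word (word_pair_correct (rev s) (0, 1)).
have : all (fun s => ((word_pair (rev s) (0, 1)) \in
    ([:: (1, 0); (0, 1); (1, 1); (2, 1); (3, 1); (3, 2)] : seq (int * int))) ==
   (s \in [seq kostant_word n | n <- iota 0 6])) reduced_words.
  by vm_compute.
move=> /allP/(_ s s_red)/eqP <-; rewrite /pos_roots.
set p := word_pair _ _.
have wt_eq x y : (wt p.1 p.2 == wt x y) = (p == (x, y)).
  apply/eqP/eqP => [/wt_inj <-|-> //]; exact: surjective_pairing.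
by rewrite !inE !wt_eq.
Qed.

Lemma kostantP w : weyl w /\ invmx w *m sroot_beta \in pos_roots <->
  exists2 n, (n < 6)%N & w = weyl_word (kostant_word n).
Proof.
have kost_red n : (n < 6)%N -> kostant_word n \in reduced_words.
  by case: n => [|[|[|[|[|[|//]]]]]].
split=> [[[s ->]]|[n n6 ->]].
  have [t t_red [-> _]] := weyl_word_reduced s.
  rewrite kostant_words // => /mapP[n]; rewrite mem_iota => n6 ->.
  by exists n.
split; first by exists (kostant_word n).
by rewrite kostant_words ?kost_red // map_f // mem_iota.
Qed.

Lemma weyl_length_kostant n : (n < 6)%N ->
  weyl_length (weyl_word (kostant_word n)) = n.
Proof.
move=> n6; rewrite weyl_length_reduced ?size_mkseq //.
by case: n n6 => [|[|[|[|[|[|//]]]]]].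
Qed.

(** [levi_weight ab + rho] lies in the open chamber w C, with C the dominant one and w the [n]-th
    Kostant representative: the shift by [rho] turns dominance of integral weights into strict
    dominance. *)
Definition chamber n ab :=
  dominant (dot_action (invmx (weyl_word (kostant_word n))) (levi_weight ab)).

Lemma chamber_inj m n ab : (m < 6)%N -> (n < 6)%N ->
  chamber m ab -> chamber n ab -> m = n.
Proof.
case: ab => a b; rewrite /chamber !invmx_weyl_word !dot_action_word.
case: m => [|[|[|[|[|[|//]]]]]] _; case: n => [|[|[|[|[|[|//]]]]]] _ //=; lia.
Qed.

(* With [c := w + 5], each difference on the right is [2 h - c], or [h - c] for
   the last one, where [h] is the pairing of [levi_weight (a, b) + rho] with a
   positive coroot other than [beta^v]; the [h]s of [(w - b, w - a)] are
   [c - h] ([2 c - h] for the last one), in reverse order. *)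
Definition off_walls (w : int) (ab : int * int) := let: (a, b) := ab in
  [/\ `|w + 5| + 2 <= `|4 * b - 2 * a - w - 3|, `|w + 5| + 2 <= `|2 * b - w - 1|,
      `|w + 5| + 2 <= `|2 * a - w + 1|, `|w + 5| + 2 <= `|4 * a - 2 * b - w + 3|
    & `|w + 5| + 1 <= `|a + b - w|].

(** Up to sign, the substitution exchanges the first difference with the fourth and the second with
    the third, and fixes the last. *)
Lemma off_walls_conj w a b : off_walls w (w - b, w - a) <-> off_walls w (a, b).
Proof. by rewrite /off_walls; split=> -[? ? ? ? ?]; split; lia. Qed.

(** Each bound says that h and its counterpart c - h (or 2 c - h) are nonzero of opposite signs. In
    chamber n the first n of the five h are negative and the others positive, the h of a + b - w
    standing third; reversing order and signs gives chamber 5 - n. *)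
Lemma off_wallsP w a b : b <= a -> off_walls w (a, b) <->
  exists n, [/\ (n < 6)%N, chamber n (a, b) & chamber (5 - n) (w - b, w - a)].
Proof.
move=> ba; split=> [|[n []]]; last first.
  rewrite /chamber !invmx_weyl_word !dot_action_word.
  case: n => [|[|[|[|[|[|//]]]]]] _ /= ? ?; split; lia.
case=> h1 h2 h3 h4 h5.
have chE n : chamber n (a, b) /\ chamber (5 - n) (w - b, w - a) -> (n < 6)%N ->
    exists n, [/\ (n < 6)%N, chamber n (a, b) & chamber (5 - n) (w - b, w - a)].
  by case=> c1 c2 n6; exists n.
(* As b <= a, the five differences increase in the order of these tests, so the index is the number
   of negative ones. *)
case: (leP 0 (4 * b - 2 * a - w - 3)) => s1; [apply: (chE 0)|
case: (leP 0 (2 * b - w - 1)) => s2; [apply: (chE 1)|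
case: (leP 0 (a + b - w)) => s3; [apply: (chE 2)|
case: (leP 0 (2 * a - w + 1)) => s4; [apply: (chE 3)|
case: (leP 0 (4 * a - 2 * b - w + 3)) => s5; [apply: (chE 4)|apply: (chE 5)]]]]] => //;
rewrite /chamber !invmx_weyl_word !dot_action_word /=; lia.
Qed.

End RootSystem.

(** * Equivalence of each condition with [off_walls] at every embedding *)

Section MainTheorem.
Variables (R : realType) (F : fieldExtType rat).
Implicit Types (mu : emb R F -> int * int) (phi : lparam R F).

(** The shift [t] (1/2 for Ad^3, 0 for the central character) cancels against the point, leaving
    signs of integers. *)
Lemma critical_shift phi (t : R) (L : place R F -> seq (int * int)) (m : int) :
  (forall v, phi v = [seq (p.1%:~R + t, p.2%:~R + t) | p <- L v]) ->
  critical phi (m%:~R - t) <->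
  forall v p, p \in L v -> (0 < m + p.1) != (0 < m + p.2).
Proof.
move=> phiE; have shift (n : int) : m%:~R - t + (n%:~R + t) = (m + n)%:~R.
  by rewrite intrD; ring.
rewrite critical_int => [|v chi].
  split=> H v; last first.
    by rewrite phiE => chi /mapP[p pv ->] /=; rewrite !shift !ltr0z (H v p pv).
  move=> p pv; have := H v (p.1%:~R + t, p.2%:~R + t).
  by rewrite phiE map_f // => /(_ isT) /=; rewrite !shift !ltr0z.
by rewrite phiE => /mapP[p _ ->] /=; rewrite !shift !intr_int.
Qed.

(* Without an embedding, [nat_min] would give [ell1] and [ell2] the junk value 0. *)
Lemma ell_off_walls mu (w : int) : inhabited (emb R F) ->
  [/\ - 3 - Posz (ell1 mu w) <= w <= - 7 + Posz (ell1 mu w),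
      - 4 - Posz (ell2 mu w) <= w <= - 6 + Posz (ell2 mu w),
      2 <= Posz (ell1 mu w) & 1 <= Posz (ell2 mu w)] <->
  forall eta, off_walls w (mu eta).
Proof.
move=> [eta0].
(* Both intervals are centred at -5, with radii l_1 - 2 and l_2 - 1. *)
have -> : [/\ - 3 - Posz (ell1 mu w) <= w <= - 7 + Posz (ell1 mu w),
      - 4 - Posz (ell2 mu w) <= w <= - 6 + Posz (ell2 mu w),
      2 <= Posz (ell1 mu w) & 1 <= Posz (ell2 mu w)] <->
    (absz (w + 5)%R + 2 <= ell1 mu w)%N /\ (absz (w + 5)%R + 1 <= ell2 mu w)%N.
  by split=> [[] /andP[? ?] /andP[? ?] ? ?|[? ?]]; split; try (apply/andP; split); lia.
rewrite /ell1 /ell2 !nat_min_ge; last 2 first.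
- by case e : (mu eta0) => [a b]; exists (absz (a + b - w)%R), eta0; rewrite e.
- case e : (mu eta0) => [a b].
  by exists (absz (4 * b - 2 * a - w - 3)%R), eta0; rewrite e inE eqxx.
split=> [[l1 l2] eta|sep].
  case e : (mu eta) => [a b].
  have := l2 _ (ex_intro _ eta _); rewrite e => /(_ _ erefl) {}l2.
  have {}l1 n : n \in map absz [:: 4 * b - 2 * a - w - 3; 2 * b - w - 1;
      2 * a - w + 1; 4 * a - 2 * b - w + 3] -> (absz (w + 5)%R + 2 <= n)%N.
    by move=> nin; apply: l1; exists eta; rewrite e.
  split; [have := l1 (absz (4 * b - 2 * a - w - 3)%R)|have := l1 (absz (2 * b - w - 1)%R)|
    have := l1 (absz (2 * a - w + 1)%R)|have := l1 (absz (4 * a - 2 * b - w + 3)%R)|lia];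
    by rewrite !inE eqxx ?orbT => /(_ isT); lia.
split=> n [eta]; have := sep eta; case: (mu eta) => a b [h1 h2 h3 h4 h5].
  by rewrite !inE => /or4P[] /eqP ->; lia.
by move=> ->; lia.
Qed.

Section Purity.
Variables (mu : emb R F -> int * int) (w : int) (sigma_f : fin_rep R F).
Hypotheses (F_imag : totally_imaginary R F) (mu_weight : is_weight mu)
  (mu_conj : forall eta, mu (conj_emb eta) = (w - (mu eta).2, w - (mu eta).1)).
Let sigma := AutRep sigma_f (J_mu mu).

(** Places select one embedding from each conjugate pair; [off_walls_conj] covers the other. *)
Lemma off_walls_places : (forall eta, off_walls w (mu eta)) <->
  forall v : place R F, off_walls w (mu (val v)).
Proof.
split=> [sep v|sep eta]; first exact: sep.
have [v [<-|ve]] := place_or_conj F_imag eta; first exact: sep.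
have := sep v; rewrite ve mu_conj.
by case: (mu eta) => a b /off_walls_conj.
Qed.

(** In additive notation the twist of Sym^3 is 2 chi_1 - chi_2, chi_1, chi_2, 2 chi_2 - chi_1;
    purity eliminates the conjugate weight. *)
Lemma Ad3_lparam_J_mu v : Ad3_lparam sigma v =
  let: (a, b) := mu (val v) in
  [seq (p.1%:~R + 1 / 2, p.2%:~R + 1 / 2) | p : int * int <-
    [:: (a - 2 * b + 1, 2 * b - a - w - 2); (- b, b - w - 1);
        (- a - 1, a - w); (b - 2 * a - 2, 2 * a - b - w + 1)]].
Proof.
rewrite /Ad3_lparam /sym3 /central_lparam /= /J_mu mu_conj.
case: (mu (val v)) => a b /=.
by congr [:: _; _; _; _]; congr pair;
  rewrite /= ?(rmorphB, rmorphD, rmorphM, rmorphN) /=; field.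
Qed.

Lemma central_lparam_J_mu v : central_lparam sigma v =
  let: (a, b) := mu (val v) in
  [seq (p.1%:~R + 0, p.2%:~R + 0) | p : int * int <-
    [:: (- a - b, a + b - 2 * w)]].
Proof.
rewrite /central_lparam /= /J_mu mu_conj.
case: (mu (val v)) => a b /=.
by congr [:: _]; congr pair; rewrite /= ?(rmorphB, rmorphD, rmorphM, rmorphN) /=; field.
Qed.

Lemma critical_off_walls :
  (critical_half_integer (Ad3_lparam sigma) (- (5 / 2)) /\
   critical_half_integer (Ad3_lparam sigma) (- (3 / 2))) /\
  (critical_integer (central_lparam sigma) (- 5) /\
   critical_integer (central_lparam sigma) (- 4)) <->
  forall eta, off_walls w (mu eta).
Proof.
pose L3 (v : place R F) : seq (int * int) := let: (a, b) := mu (val v) in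
  [:: (a - 2 * b + 1, 2 * b - a - w - 2); (- b, b - w - 1);
      (- a - 1, a - w); (b - 2 * a - 2, 2 * a - b - w + 1)].
pose L1 (v : place R F) : seq (int * int) := let: (a, b) := mu (val v) in
  [:: (- a - b, a + b - 2 * w)].
have Ad3E v : Ad3_lparam sigma v = [seq (p.1%:~R + 1 / 2, p.2%:~R + 1 / 2) | p <- L3 v].
  by rewrite Ad3_lparam_J_mu /L3; case: (mu (val v)).
have centE v : central_lparam sigma v = [seq (p.1%:~R + 0, p.2%:~R + 0) | p <- L1 v].
  by rewrite central_lparam_J_mu /L1; case: (mu (val v)).
have half_int (m : int) (s : R) : s = m%:~R - 1 / 2 ->
    critical_half_integer (Ad3_lparam sigma) s <->
    forall v p, p \in L3 v -> (0 < m + p.1) != (0 < m + p.2).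
  move=> ->; rewrite -(critical_shift m Ad3E) /critical_half_integer.
  split=> [[]//|crit]; split=> //.
  by rewrite (_ : _ - _ = (m - 1)%:~R) ?intr_int // intrB; field.
have int_pt (m : int) (s : R) : s = m%:~R - 0 ->
    critical_integer (central_lparam sigma) s <->
    forall v p, p \in L1 v -> (0 < m + p.1) != (0 < m + p.2).
  move=> ->; rewrite -(critical_shift m centE) /critical_integer.
  split=> [[]//|crit]; split=> //.
  by rewrite subr0 intr_int.
rewrite (half_int (-2)); last by field.
rewrite (half_int (-1)); last by field.
rewrite (int_pt (-5)); last by field.
rewrite (int_pt (-4)); last by field.
rewrite off_walls_places; split=> [[[c1 c2] [c3 c4]] v|sep].
  have := (c1 v, c2 v, c3 v, c4 v); rewrite /L3 /L1.
  case: (mu (val v)) => a b {c1 c2 c3 c4} [[[c1 c2] c3] c4].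
  (* At -5 and -4 the central pair has maximum >= 6, minimum <= 4 and sum -2w, so its difference 2
     |a + b - w| is at least 2 |w + 5| + 2. *)
  have := c3 (- a - b, a + b - 2 * w); have := c4 (- a - b, a + b - 2 * w).
  rewrite !inE eqxx => /(_ isT) /= {}c4 /(_ isT) /= {}c3.
  (* At the shifts -2 and -1 the signs force maximum >= 3 and minimum <= 1; as the sum is -w - 1,
     the difference is at least both w + 7 and -w - 3. *)
  have c p : p \in [:: (a - 2 * b + 1, 2 * b - a - w - 2); (- b, b - w - 1);
      (- a - 1, a - w); (b - 2 * a - 2, 2 * a - b - w + 1)] ->
      `|w + 5| + 2 <= `|p.1 - p.2|.
    move=> pin; have := c1 p pin; have := c2 p pin.
    move: pin; rewrite !inE => /or4P[] /eqP -> /=; lia.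
  split; [have := c (a - 2 * b + 1, 2 * b - a - w - 2) | have := c (- b, b - w - 1) |
    have := c (- a - 1, a - w) | have := c (b - 2 * a - 2, 2 * a - b - w + 1) | lia];
    by rewrite !inE eqxx ?orbT => /(_ isT) /=; lia.
split; split=> v; have := sep v; rewrite /L3 /L1; case: (mu (val v)) => a b;
  case=> h1 h2 h3 h4 h5 p; rewrite !inE.
- by case/or4P => /eqP -> /=; lia.
- by case/or4P => /eqP -> /=; lia.
- by move=> /eqP -> /=; lia.
- by move=> /eqP -> /=; lia.
Qed.

Lemma balanced_off_walls :
  (exists kappa : emb R F -> 'M[int]_2,
     [/\ kostant_rep kappa, balanced kappa & inv_dot_dominant kappa mu]) <->
  forall eta, off_walls w (mu eta).
Proof.
have conjE eta : (w - (mu eta).2, w - (mu eta).1) = mu (conj_emb eta) by rewrite mu_conj.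
split=> [[kappa [kost bal dom]] eta|sep].
  have /kostantP[m m6 mE] := kost eta.
  have /kostantP[n n6 nE] := kost (conj_emb eta).
  have := bal eta; rewrite mE nE !weyl_length_kostant // => mn.
  have := dom eta; have := dom (conj_emb eta); rewrite mE nE => domn domm.
  rewrite [mu eta]surjective_pairing off_wallsP; last exact: mu_weight.
  exists m; rewrite conjE -surjective_pairing; split=> //.
  by rewrite -mn addKn.
have /choice[k kP] : forall eta, exists n, [/\ (n < 6)%N, chamber n (mu eta) &
    chamber (5 - n) (mu (conj_emb eta))].
  move=> eta; have := sep eta.
  by rewrite {1}[mu eta]surjective_pairing off_wallsP ?conjE -?surjective_pairing.
exists (fun eta => weyl_word (kostant_word (k eta))).
split=> eta; have [k6 ck ck'] := kP eta.
- by apply/kostantP; exists (k eta).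
- have [k6' ck'' _] := kP (conj_emb eta).
  (* The indices are chosen independently at each embedding; disjointness of the chambers forces the
     one at the conjugate to be [5 - k eta]. *)
  rewrite !weyl_length_kostant // (chamber_inj _ _ ck'' ck') // ?subnKC //.
  by rewrite ltnS leq_subr.
- exact: ck.
Qed.

End Purity.

End MainTheorem.

Theorem lemma7p1 (R : realType) (F : fieldExtType rat)
    (F_imag : totally_imaginary R F)
    (mu : emb R F -> int * int) (w : int)
    (mu_weight : is_weight mu) (mu_pure : strongly_pure mu w)
    (sigma_f : fin_rep R F) (sigma_coh : Coh mu sigma_f) :
  let sigma := AutRep sigma_f (J_mu mu) in
  let l1 : int := Posz (ell1 mu w) in
  let l2 : int := Posz (ell2 mu w) in
  let cond1 :=
    (critical_half_integer (Ad3_lparam sigma) (- (5 / 2)) /\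
     critical_half_integer (Ad3_lparam sigma) (- (3 / 2))) /\
    (critical_integer (central_lparam sigma) (- 5) /\
     critical_integer (central_lparam sigma) (- 4)) in
  let cond2 :=
    [/\ - 3 - l1 <= w <= - 7 + l1, - 4 - l2 <= w <= - 6 + l2,
        2 <= l1 & 1 <= l2] in
  let cond3 :=
    exists kappa : emb R F -> 'M[int]_2,
      [/\ kostant_rep kappa, balanced kappa & inv_dot_dominant kappa mu] in
  (cond1 <-> cond2) /\ (cond2 <-> cond3).
Proof.
have mu_conj := strongly_pure_conj mu_pure.
have emb_ex : inhabited (emb R F) := number_field_embedding R[i] F.
rewrite /= (ell_off_walls _ _ emb_ex) (balanced_off_walls mu_weight mu_conj).
by rewrite (critical_off_walls sigma_f F_imag mu_conj).
Qed.
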